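(* Let $m \in \mathbb{N}$, $s_1, \dots, s_m \in \mathbb{N}_0$. Then for any positive integer $n$, $$H_n^*[\{2\}^{s_1}, 1, \{2\}^{s_2}, 1, \dots, \{2\}^{s_m}, 1] = \sum_{\mathbf{p}=(2s_1+1)\circ(2s_2+1)\circ\dots\circ(2s_m+1)} \widehat{\mathcal{H}}_n[\mathbf{p}; \widetilde{\mathbf{p}}],$$ where $\circ$ is either comma or plus, and the string $\widetilde{\mathbf{p}} := (s_1 + 1) \circ (s_2 + 1) \circ \dots \circ (s_m + 1)$ is associated with the string $\mathbf{p}$, i.e. the choice of commas and pluses in $\mathbf{p}$ and $\widetilde{\mathbf{p}}$ is the same.
   Context: Let $0<q<1$, $[n]_q = \frac{1-q^n}{1-q}$, $(q)_n=\prod_{k=0}^{n-1}(1-q^{k+1})$, and $\begin{bmatrix} n \\ m \end{bmatrix} = \frac{(q)_n}{(q)_m (q)_{n-m}}$ for $0\le m\le n$, $0$ otherwise. For non-negative integers $n,m$ and $\mathbf{s}=(s_1,\dots,s_m)$, $\mathbf{t}=(t_1,\dots,t_m)\in\mathbb{Z}^m$ define $H_n^*[\mathbf{s}] = \sum_{n \geq k_1 \geq \dots \geq k_m \geq 1} \prod_{j=1}^m \frac{q^{k_j}}{[k_j]_q^{s_j}}$, $\mathcal{H}_n[\mathbf{s};\mathbf{t}] = \sum_{n \geq k_1 > \dots > k_m \geq 1} \prod_{j=1}^m \frac{q^{(t_j-1)k_j}(1+q^{k_j})}{[k_j]_q^{s_j}}$ (zero if $n<m$; equal to $1$ for $m=0$),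 and $\widehat{\mathcal{H}}_n[\mathbf{s}; \mathbf{t}] = \sum_{k=1}^n \frac{\begin{bmatrix} n \\ k \end{bmatrix}}{\begin{bmatrix} n+k \\ k \end{bmatrix}} \frac{q^{k^2+(t_1-1)k}(1+q^k)}{[k]_q^{s_1}} \mathcal{H}_{k-1}[s_2, \dots, s_m; t_2, \dots, t_m]$, with $\widehat{\mathcal{H}}_n[\mathbf{s};\mathbf{t}]=0$ if $n<m$ and $=1$ if $m=0$. $\{2\}^a$ denotes $a$ consecutive 2's. *)

(* Defs.v *)
From mathcomp Require Import all_boot all_order all_algebra.
From mathcomp Require Import reals.

Set Implicit Arguments.
Unset Strict Implicit.
Unset Printing Implicit Defensive.

Import Order.TTheory GRing.Theory Num.Theory.

Local Open Scope ring_scope.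

Definition qnum (R : realType) (q : R) (n : nat) : R := (1 - q ^+ n) / (1 - q).

Definition qfact (R : realType) (q : R) (n : nat) : R :=
  \prod_(k < n) (1 - q ^+ k.+1).

Definition qbinom (R : realType) (q : R) (n m : nat) : R :=
  if (m <= n)%N then qfact q n / (qfact q m * qfact q (n - m)) else 0.

(* Argument strings are sequences of integers. The paper's 1-based entry s_j
   is s`_j with j counted from 0, and the depth m is size s. *)

(* [sorted geq] is k_1 >= k_2 >= ..., [sorted gtn] below is k_1 > k_2 > ... *)
Definition Hstar (R : realType) (q : R) (n : nat) (s : seq int) : R :=
  \sum_(k : (size s).-tuple 'I_n.+1 |
          sorted geq (map val k) && all (leq 1) (map val k))
    \prod_(j < size s)
      (q ^+ tnth k j / qnum q (tnth k j) ^ s`_j).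

(* Meant for size t = size s. The conventions (1 at depth 0, and 0 when n is
   less than the depth) hold automatically, both here and for Hhat. *)
Definition calH (R : realType) (q : R) (n : nat) (s t : seq int) : R :=
  \sum_(k : (size s).-tuple 'I_n.+1 |
          sorted gtn (map val k) && all (leq 1) (map val k))
    \prod_(j < size s)
      (q ^ ((t`_j - 1) * (tnth k j)%:Z) * (1 + q ^+ tnth k j)
         / qnum q (tnth k j) ^ s`_j).

Definition Hhat (R : realType) (q : R) (n : nat) (s t : seq int) : R :=
  if s is s1 :: s' then
    \sum_(1 <= k < n.+1)
      qbinom q n k / qbinom q (n + k) k
      * (q ^ ((k ^ 2)%N%:Z + (head 0 t - 1) * k%:Z) * (1 + q ^+ k)
           / qnum q k ^ s1)
      * calH q k.-1 s' (behead t)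
  else 1.

(* The string x_1 o x_2 o ... o x_m, where the i-th separator "o" is a plus if
   the i-th entry of c is true and a comma if it is false; c is meant to have
   one entry less than x. *)
Fixpoint circ_from (a : int) (c : seq bool) (x : seq int) : seq int :=
  match c, x with
  | b :: c', y :: x' =>
      if b then circ_from (a + y) c' x' else a :: circ_from y c' x'
  | _, _ => [:: a]
  end.

Definition circ (c : seq bool) (x : seq int) : seq int :=
  if x is a :: x' then circ_from a c x' else [::].

(* {2}^{s_1}, 1, {2}^{s_2}, 1, ..., {2}^{s_m}, 1 *)
Definition twos_ones (s : seq nat) : seq int :=
  flatten [seq rcons (nseq a (2 : int)) 1 | a <- s].

(* Main.v *)
(** Both sides have the form [S_n(f) = sum_k w_n(k) f(k)] with
    [w_n(k) = qbinom n k / qbinom (n+k) k * q^(k^2)]: the empty string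
    corresponds to [f(k) = [k = 0]], and prepending 2 or 1 to the string on the
    left corresponds to an explicit operation on [f]. The weights satisfy
    [w_n(k) - w_(n-1)(k) = w_n(k) q^(n-k) [k]^2 / [n]^2], so prepending 2, for
    which the new sum has n-th increment [q^n / [n]^2] times the old sum, turns
    [f] into [q^k / [k]^2 f(k)]. Prepending 1 turns [f] into
    [((1 + q^k) sum_(j<k) f(j) + q^k f(k)) / [k]], because
    [([n] - [k]) w_n(k)] telescopes. The two terms are exactly the choices
    "comma" and "plus" for the next separator. *)

Require Import Defs.
From mathcomp Require Import all_boot all_order all_algebra.
From mathcomp Require Import reals.
From mathcomp Require Import ring zify.

Set Implicit Arguments.
Unset Strict Implicit.
Unset Printing Implicit Defensive.

Import Order.TTheory GRing.Theory Num.Theory.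

Local Open Scope ring_scope.

(** * Nested sums over tuples, peeled off one index at a time *)

Section TupleSums.

Variable R : comPzRingType.

Lemma big_tuple0 (T : finType) (F : seq T -> R) :
  \sum_(k : 0.-tuple T) F k = F [::].
Proof. by rewrite (big_pred1 [tuple]) // => k; apply/esym/eqP; apply: tuple0. Qed.

Lemma big_tuple_recl (T : finType) (m : nat) (F : seq T -> R) :
  \sum_(k : m.+1.-tuple T) F k = \sum_(x : T) \sum_(k : m.-tuple T) F (x :: k).
Proof.
rewrite pair_big /=.
rewrite (reindex (fun p : T * m.-tuple T => [tuple of p.1 :: p.2])) //=.
exists (fun t : m.+1.-tuple T => (thead t, [tuple of behead t])) => [[x k]|t] _.
  by congr pair; apply: val_inj.
by rewrite -tuple_eta.
Qed.

(** Once the first index is fixed, the inner sum still carries the outer bound [N]; this shrinks the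
    range to the bound that the first index imposes. *)
Lemma big_tuple_ord_widen (m n N : nat) (F : seq nat -> R) : (n <= N)%N ->
  (forall l, ~~ all (fun y => y <= n)%N l -> F l = 0) ->
  \sum_(k : m.-tuple 'I_N.+1) F (map val k)
    = \sum_(k : m.-tuple 'I_n.+1) F (map val k).
Proof.
move=> le_nN; elim: m F => [|m IHm] F F0.
  rewrite (big_tuple0 (fun l : seq 'I_N.+1 => F (map val l))).
  by rewrite (big_tuple0 (fun l : seq 'I_n.+1 => F (map val l))).
rewrite (big_tuple_recl _ (fun l : seq 'I_N.+1 => F (map val l))).
rewrite (big_tuple_recl _ (fun l : seq 'I_n.+1 => F (map val l))) /=.
rewrite (big_ord_widen N.+1
  (fun x => \sum_(k : m.-tuple 'I_n.+1) F (x :: map val k))) //.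
rewrite [RHS]big_mkcond /=; apply: eq_bigr => x _.
rewrite (IHm (fun l => F (nat_of_ord x :: l))) ?ltnS.
  case: leqP => // lt_nx; rewrite big1 // => k _.
  by apply: F0; rewrite /= leqNgt lt_nx.
by move=> l Hl; apply: F0; rewrite /= negb_and Hl orbT.
Qed.

(** Common form of [Hstar] ([r] is [geq]) and [calH] ([r] is [gtn]). *)
Definition chain_sum (r : rel nat) (f : nat -> nat -> R) (m N : nat) : R :=
  \sum_(k : m.-tuple 'I_N.+1 | sorted r (map val k) && all (leq 1) (map val k))
    \prod_(j < m) f j (tnth k j).

(** Extension by zero to all sequences of naturals, free of the bound [N], so that sums with
    different bounds can be compared. *)
Definition chain_term (r : rel nat) (f : nat -> nat -> R) m (l : seq nat) : R :=
  if sorted r l && all (leq 1) l then \prod_(j < m) f j (nth 0%N l j) else 0.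

Lemma chain_sumE r f m N :
  chain_sum r f m N = \sum_(k : m.-tuple 'I_N.+1) chain_term r f m (map val k).
Proof.
rewrite /chain_sum big_mkcond; apply: eq_bigr => k _; rewrite /chain_term.
case: ifP => // _; apply: eq_bigr => j _; congr (f j _).
by rewrite (nth_map ord0) ?size_tuple // -tnth_nth.
Qed.

Lemma chain_sum0 r f N : chain_sum r f 0 N = 1.
Proof.
rewrite chain_sumE (big_tuple0 (fun l : seq 'I_N.+1 => chain_term r f 0 (map val l))).
by rewrite /chain_term big_ord0.
Qed.

(* [b] is id for k_1 >= k_2 >= ... and predn for k_1 > k_2 > ... *)
Lemma chain_sum_recl (r : rel nat) (b : nat -> nat) f m N :
  transitive r -> (forall x, b x <= x)%N ->
  (forall x y, 0 < x -> r x y = (y <= b x))%N ->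
  chain_sum r f m.+1 N
    = \sum_(1 <= x < N.+1) f 0 x * chain_sum r (fun j => f j.+1) m (b x).
Proof.
move=> r_tr b_le rE.
rewrite chain_sumE (big_tuple_recl _ (fun l : seq 'I_N.+1 => chain_term r f m.+1 (map val l))) /=.
rewrite -(big_mkord xpredT (fun x => \sum_(k : m.-tuple 'I_N.+1)
  chain_term r f m.+1 (x :: map val k))).
(* A first index 0 contributes nothing, since all indices are at least 1. *)
rewrite big_nat_recl // big_add1 big1 ?add0r => [|k _]; last first.
  by rewrite /chain_term andbF.
apply: eq_big_nat => x /andP[_ lt_xN].
have bx := leq_trans (b_le x.+1) lt_xN.
(* By transitivity, the chain condition bounds every later index by [b x.+1], not only the next
   one. *)
have pathE l : path r x.+1 l = all (fun y => y <= b x.+1)%N l && sorted r l.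
  by rewrite path_sortedE //; congr (_ && _); apply: eq_all => y; rewrite rE.
rewrite (big_tuple_ord_widen (F := fun l => chain_term r f m.+1 (x.+1 :: l)) _ bx).
  rewrite chain_sumE big_distrr /=; apply: eq_bigr => k _.
  rewrite /chain_term /= pathE.
  have -> : all (fun y => y <= b x.+1)%N (map val k).
    by apply/allP => _ /mapP[y _ ->]; rewrite -ltnS ltn_ord.
  rewrite /=; case: ifP => _; last by rewrite mulr0.
  by rewrite big_ord_recl.
by move=> l /negbTE nl; rewrite /chain_term /= pathE nl.
Qed.

End TupleSums.

(** * Recursions for the harmonic sums, and q-numbers *)

Section QSums.

Variables (R : realType) (q : R).
Hypotheses (q_gt0 : 0 < q) (q_lt1 : q < 1).

Lemma Hstar_nil n : Hstar q n [::] = 1.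
Proof. exact: (chain_sum0 geq (fun j k => q ^+ k / qnum q k ^ [::]`_j) n). Qed.

Lemma Hstar_cons n a s : Hstar q n (a :: s) =
  \sum_(1 <= k < n.+1) q ^+ k / qnum q k ^ a * Hstar q k s.
Proof.
exact: (@chain_sum_recl _ geq id (fun j k => q ^+ k / qnum q k ^ (a :: s)`_j)
  (size s) n (rev_trans leq_trans)).
Qed.

Lemma calH_nil n t : calH q n [::] t = 1.
Proof.
exact: (chain_sum0 gtn (fun j k => q ^ ((t`_j - 1) * k%:Z) * (1 + q ^+ k)
  / qnum q k ^ [::]`_j) n).
Qed.

(** Up to the weight [hatw], this is also the summand of [Hhat]. *)
Definition calH_term (s t : seq int) (k : nat) : R :=
  q ^ ((head 0 t - 1) * k%:Z) * (1 + q ^+ k) / qnum q k ^ head 0 s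
    * calH q k.-1 (behead s) (behead t).

Lemma calH_cons n a s t : calH q n (a :: s) t =
  \sum_(1 <= k < n.+1) calH_term (a :: s) t k.
Proof.
rewrite /calH_term /= -nth0.
have := @chain_sum_recl _ gtn predn (fun j k => q ^ ((t`_j - 1) * k%:Z)
  * (1 + q ^+ k) / qnum q k ^ (a :: s)`_j) (size s) n (rev_trans ltn_trans)
  leq_pred.
rewrite /calH /chain_sum /= => ->; last by case.
apply: eq_bigr => k _; congr (_ * _); apply: eq_bigr => l _; apply: eq_bigr => j _.
by rewrite nth_behead.
Qed.

Lemma expq_lt1 k : (0 < k)%N -> q ^+ k < 1.
Proof. by move=> k0; rewrite exprn_ilt1 ?ltW // -lt0n. Qed.

Lemma subr_expq_neq0 k : (0 < k)%N -> 1 - q ^+ k != 0.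
Proof. by move=> k0; rewrite subr_eq0 eq_sym lt_eqF // expq_lt1. Qed.

Lemma subr_q_neq0 : 1 - q != 0.
Proof. by rewrite subr_eq0 eq_sym lt_eqF. Qed.

Lemma qnum0 : qnum q 0 = 0.
Proof. by rewrite /qnum expr0 subrr mul0r. Qed.

Lemma qnum_neq0 k : (0 < k)%N -> qnum q k != 0.
Proof. by move=> k0; rewrite mulf_neq0 ?invr_eq0 ?subr_q_neq0 ?subr_expq_neq0. Qed.

Lemma qfactS n : qfact q n.+1 = qfact q n * (1 - q ^+ n.+1).
Proof. by rewrite /qfact big_ord_recr. Qed.

Lemma qfact_neq0 n : qfact q n != 0.
Proof. by apply/prodf_neq0 => k _; rewrite subr_expq_neq0. Qed.

(** * The weights and their differences in [n] and in [k] *)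

Definition hatw (n k : nat) : R :=
  qbinom q n k / qbinom q (n + k) k * q ^+ (k ^ 2).

Lemma hatwE n k : (k <= n)%N -> hatw n k =
  qfact q n ^+ 2 / (qfact q (n - k) * qfact q (n + k)) * q ^+ (k ^ 2).
Proof.
move=> le_kn; rewrite /hatw /qbinom le_kn leq_addl addnK; field.
by rewrite !qfact_neq0.
Qed.

Lemma hatw_gt n k : (n < k)%N -> hatw n k = 0.
Proof. by move=> lt_nk; rewrite /hatw /qbinom leqNgt lt_nk !mul0r. Qed.

Lemma hatwn0 n : hatw n 0 = 1.
Proof.
rewrite hatwE // subn0 addn0 expr0 mulr1 -expr2 divff //.
by rewrite expf_neq0 ?qfact_neq0.
Qed.

(** With $x = q^{n+1-k}$ and $y = q^k$, the ratio of [hatw n k] to [hatw n.+1 k] is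
    $(1-x)(1-xy^2)/(1-xy)^2$, and $(1-xy)^2 - (1-x)(1-xy^2) = x(1-y)^2$. *)
Lemma hatw_diff n k : (k <= n.+1)%N ->
  hatw n.+1 k - hatw n k
    = hatw n.+1 k * (q ^+ (n.+1 - k) * qnum q k ^+ 2 / qnum q n.+1 ^+ 2).
Proof.
have nz1 := subr_q_neq0; have nzn := subr_expq_neq0 (ltn0Sn n).
rewrite leq_eqVlt => /predU1P[->|lt_kn].
  (* At [k = n.+1] the weight [hatw n k] is 0 and the factor on the right is 1. *)
  rewrite (@hatw_gt n) // subr0 subnn expr0 mul1r divff ?mulr1 //.
  by rewrite expf_neq0 ?qnum_neq0.
rewrite ltnS in lt_kn.
rewrite !hatwE ?(leqW lt_kn) // subSn // addSn !qfactS /qnum.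
have nza := subr_expq_neq0 (ltn0Sn (n - k)).
have nzb := subr_expq_neq0 (ltn0Sn (n + k)).
have nf i := qfact_neq0 i.
have Ea : q ^+ n.+1 = q ^+ (n - k).+1 * q ^+ k.
  by rewrite -exprD addSn subnK.
have Eb : q ^+ (n + k).+1 = q ^+ (n - k).+1 * q ^+ k * q ^+ k.
  by rewrite -!exprD; congr (_ ^+ _); lia.
move: nzn nza nzb; rewrite Eb Ea => nzn nza nzb; field.
by rewrite nza nzn nzb nz1 !nf.
Qed.

(** The coefficients of [hatw n k.+1] add up to $q^{-(k+1)}(1-q^{n+k+1})/(1-q)$, and the ratio of
    [hatw n k.+1] to [hatw n k] is $q^{2k+1}(1-q^{n-k})/(1-q^{n+k+1})$. *)
Lemma hatw_step n k : (k < n)%N ->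
  (qnum q n - qnum q k) * hatw n k
    = hatw n k.+1 * qnum q k.+1 * (1 + q ^- k.+1)
      + (qnum q n - qnum q k.+1) * hatw n k.+1.
Proof.
move=> lt_kn.
have nzq i : q ^+ i != 0 by rewrite expf_neq0 ?gt_eqF.
have nz1 := subr_q_neq0.
have nza : 1 - q ^+ (n - k) != 0 by rewrite subr_expq_neq0 ?subn_gt0.
have nzb : 1 - q ^+ (n + k).+1 != 0 by rewrite subr_expq_neq0.
have nf i := qfact_neq0 i.
rewrite !hatwE ?(ltnW lt_kn) // addnS qfactS.
have Esub : (n - k = (n - k.+1).+1)%N by lia.
rewrite Esub qfactS -Esub /qnum.
have Ea : q ^+ n = q ^+ (n - k) * q ^+ k by rewrite -exprD subnK // ltnW.
have Eb : q ^+ (n + k).+1 = q ^+ (n - k) * q ^+ k * q ^+ k * q.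
  by rewrite -!exprD -exprSr; congr (_ ^+ _); lia.
have Ec : q ^+ (k.+1 ^ 2) = q ^+ (k ^ 2) * q ^+ k * q ^+ k * q.
  by rewrite -!exprD -exprSr; congr (_ ^+ _); lia.
move: nza nzb; rewrite Eb Ec Ea [q ^+ k.+1]exprSr => nza nzb; field.
by rewrite ?nza ?nzb ?nz1 ?nf ?nzq ?(gt_eqF q_gt0).
Qed.

(** * Weighted sums and the effect of prepending 2 or 1 *)

Definition hat_sum (n : nat) (f : nat -> R) : R :=
  \sum_(0 <= k < n.+1) hatw n k * f k.

Lemma hat_sum_diff n f : hat_sum n.+1 f - hat_sum n f =
  q ^+ n.+1 / qnum q n.+1 ^+ 2
    * hat_sum n.+1 (fun k => q ^- k * qnum q k ^+ 2 * f k).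
Proof.
(* The added term [k = n.+1] has weight 0. *)
have -> : hat_sum n f = \sum_(0 <= k < n.+2) hatw n k * f k.
  by rewrite big_nat_recr //= hatw_gt // mul0r addr0.
rewrite /hat_sum -sumrB big_distrr /=; apply: eq_big_nat => k /andP[_ lt_kn].
rewrite -mulrBl hatw_diff // expfB_cond; last by rewrite gt_eqF.
ring.
Qed.

Lemma Hstar_consS n a s : Hstar q n.+1 (a :: s) =
  Hstar q n (a :: s) + q ^+ n.+1 / qnum q n.+1 ^ a * Hstar q n.+1 s.
Proof. by rewrite !Hstar_cons big_nat_recr. Qed.

(** Induction on [n]: both sides vanish at 0, and by [hat_sum_diff] the second hypothesis equates
    their increments. *)
Lemma Hstar_cons_hat_sum a s f : f 0%N = 0 ->
  (forall n, hat_sum n.+1 (fun k => q ^- k * qnum q k ^+ 2 * f k)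
     / qnum q n.+1 ^+ 2 = Hstar q n.+1 s / qnum q n.+1 ^ a) ->
  forall n, Hstar q n (a :: s) = hat_sum n f.
Proof.
move=> f0 fE; elim=> [|n IHn].
  by rewrite Hstar_cons big_geq // /hat_sum big_nat1 f0 mulr0.
apply/eqP; rewrite -subr_eq0 Hstar_consS IHn -[hat_sum n.+1 f](subrK (hat_sum n f)).
rewrite hat_sum_diff -!mulrA [_^-1 * Hstar _ _ _]mulrC -fE.
by apply/eqP; ring.
Qed.

Lemma Hstar_two s f : f 0%N = 0 -> (forall n, Hstar q n s = hat_sum n f) ->
  forall n, Hstar q n (2 :: s) =
    hat_sum n (fun k => q ^+ k / qnum q k ^+ 2 * f k).
Proof.
move=> f0 sE; apply: Hstar_cons_hat_sum => [|n]; first by rewrite f0 mulr0.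
rewrite sE -[qnum q n.+1 ^ 2]/(qnum q n.+1 ^+ 2); congr (_ / _).
(* At [k = 0] the powers of [qnum q k] do not cancel, but [f] vanishes there. *)
apply: eq_bigr => -[|k] _; first by rewrite f0 !mulr0.
congr (_ * _); field.
by rewrite qnum_neq0 // expf_neq0 ?gt_eqF.
Qed.

(** Summation by parts: by [hatw_step] the partial sums [D M] of the difference have a closed form
    with the factor [qnum q M - qnum q n], which is 0 at [M = n]. *)
Lemma hat_sum_one n f :
  hat_sum n (fun k => qnum q k * ((1 + q ^- k) * (\sum_(0 <= j < k) f j) + f k))
    = qnum q n * hat_sum n f.
Proof.
pose D M := \sum_(0 <= k < M.+1) (hatw n k * (qnum q k *
  ((1 + q ^- k) * (\sum_(0 <= j < k) f j) + f k)) - qnum q n * (hatw n k * f k)).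
suff DE M : (M <= n)%N ->
    D M = (qnum q M - qnum q n) * hatw n M * \sum_(0 <= j < M.+1) f j.
  by apply/subr0_eq; rewrite /hat_sum big_distrr -sumrB [LHS]DE // subrr !mul0r.
elim: M => [|M IHM] le_Mn.
  by rewrite /D !big_nat1 big_geq // qnum0 hatwn0; ring.
rewrite /D big_nat_recr //= [X in X + _]IHM ?(ltnW le_Mn) //.
rewrite -opprB !mulNr hatw_step // (big_nat_recr M.+1) //=.
ring.
Qed.

(** For [k > 0], this is [q ^+ k / qnum q k ^+ 2] times the coefficient in [hat_sum_one]; the extra
    factor cancels the one produced by [hat_sum_diff]. *)
Definition one_coef (f : nat -> R) (k : nat) : R :=
  ((1 + q ^+ k) * (\sum_(0 <= j < k) f j) + q ^+ k * f k) / qnum q k.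

Lemma one_coef0 f : one_coef f 0 = 0.
Proof. by rewrite /one_coef qnum0 invr0 mulr0. Qed.

Lemma Hstar_one s f : (forall n, Hstar q n s = hat_sum n f) ->
  forall n, Hstar q n (1 :: s) = hat_sum n (one_coef f).
Proof.
move=> sE; apply: Hstar_cons_hat_sum => [|n]; first exact: one_coef0.
rewrite sE expr1z.
have -> : hat_sum n.+1 (fun k => q ^- k * qnum q k ^+ 2 * one_coef f k)
    = qnum q n.+1 * hat_sum n.+1 f.
  rewrite -hat_sum_one; apply: eq_bigr => -[|k] _; congr (_ * _).
    by rewrite one_coef0 qnum0 mulr0 mul0r.
  by rewrite /one_coef; field; rewrite qnum_neq0 // expf_neq0 ?gt_eqF.
by field; rewrite qnum_neq0.
Qed.

Fixpoint hat_coef (s : seq nat) (k : nat) : R :=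
  if s is a :: s' then (q ^+ k / qnum q k ^+ 2) ^+ a * one_coef (hat_coef s') k
  else (k == 0%N)%:R.

Lemma Hstar_twos_ones s n : Hstar q n (twos_ones s) = hat_sum n (hat_coef s).
Proof.
elim: s n => [|a s IHs] n.
  rewrite Hstar_nil /hat_sum big_nat_recl // hatwn0 mulr1 big1 ?addr0 // => k _.
  by rewrite mulr0.
rewrite /twos_ones /= cat_rcons -/(twos_ones s).
elim: a n => [|a IHa] n.
  rewrite (Hstar_one IHs); apply: eq_bigr => k _.
  by rewrite /= mul1r.
(* [Hstar_two] applies because the 1 closing the block already makes the coefficient vanish at 0. *)
rewrite (Hstar_two _ IHa) /= ?one_coef0 ?mulr0 //.
by apply: eq_bigr => k _; rewrite /= [_ ^+ a.+1]exprS !mulrA.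
Qed.

(** * Summing over the choices of commas and pluses *)

Lemma circ_from_addl (x y : int) c s : size c = size s ->
  circ_from (x + y) c s = x + head 0 (circ_from y c s) :: behead (circ_from y c s).
Proof.
elim: c s y => [|b c IHc] [|z s] y //= [sz_cs].
by case: b => //=; rewrite -addrA IHc.
Qed.

Lemma circ_from_cons y c s :
  circ_from y c s = head 0 (circ_from y c s) :: behead (circ_from y c s).
Proof. by elim: c s y => [|[] c IHc] [|z s] y //=. Qed.

(** The leading entries occur only as exponents, so a summand merged into them by a plus factors
    out. *)
Lemma calH_term_addl x y x' y' c u v k : size c = size u -> size c = size v ->
  (0 < k)%N ->
  calH_term (circ_from (x + y) c u) (circ_from (x' + y') c v) k
    = q ^ (x' * k%:Z) / qnum q k ^ x
      * calH_term (circ_from y c u) (circ_from y' c v) k.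
Proof.
move=> szu szv k0; rewrite !circ_from_addl // /calH_term /=.
rewrite -addrA mulrDl expfzDr ?gt_eqF // expfzDr ?qnum_neq0 // invfM.
ring.
Qed.

(** Induction on [s], splitting on the first separator: plus and comma yield the two summands of
    [one_coef]. *)
Lemma sum_circ (s : seq nat) a k : (0 < k)%N ->
  \sum_(c : (size s).-tuple bool)
    calH_term (circ c [seq (2 * a + 1)%N%:Z | a <- a :: s])
              (circ c [seq (a + 1)%N%:Z | a <- a :: s]) k
  = hat_coef (a :: s) k.
Proof.
have headE b i : q ^ (((b + 1)%N%:Z - 1) * i%:Z) = (q ^+ i) ^+ b.
  by rewrite PoszD addrK -PoszM mulnC -exprM.
elim: s a k => [|b s IHs] a k k0.
  rewrite (big_tuple0 (fun c => calH_term (circ c [:: (2 * a + 1)%N%:Z])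
    (circ c [:: (a + 1)%N%:Z]) k)) /calH_term /= calH_nil mulr1 headE.
  (* The coefficient of the empty string lives at 0 only, so just [j = 0] survives. *)
  rewrite /one_coef big_ltn // big_nat_cond big1 ?addr0 => [|j]; last first.
    by rewrite andbT => /andP[/lt0n_neq0/negbTE->].
  rewrite eqxx (gtn_eqF k0) mulr0 addr0 mulr1.
  rewrite -[_ ^ Posz _]/(qnum q k ^+ (2 * a + 1)) exprD exprM expr1.
  rewrite [(_ / _) ^+ a]expr_div_n.
  by rewrite invfM; ring.
rewrite (big_tuple_recl _ (fun c => calH_term
  (circ c [seq (2 * a + 1)%N%:Z | a <- [:: a, b & s]])
  (circ c [seq (a + 1)%N%:Z | a <- [:: a, b & s]]) k)) big_bool /=.
(* Plus: the merged entries share a single [- 1] in the exponent of [q], whence the power [a.+1]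
   instead of [a]. *)
have -> : \sum_(c : (size s).-tuple bool) calH_term
    (circ_from ((2 * a + 1)%N%:Z + (2 * b + 1)%N%:Z) c
      [seq (2 * a + 1)%N%:Z | a <- s])
    (circ_from ((a + 1)%N%:Z + (b + 1)%N%:Z) c [seq (a + 1)%N%:Z | a <- s]) k
  = (q ^+ k) ^+ a.+1 / qnum q k ^+ (2 * a + 1) * hat_coef (b :: s) k.
  rewrite -IHs // big_distrr; apply: eq_bigr => c _.
  rewrite calH_term_addl ?size_map ?size_tuple // -PoszM addn1.
  by rewrite -[_ ^ Posz (a.+1 * k)]/(q ^+ (a.+1 * k)) mulnC exprM.
(* Comma: the remaining string sits in [calH] with bound [k.-1], giving the sum over [j < k]. *)
have -> : \sum_(c : (size s).-tuple bool) calH_term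
    ((2 * a + 1)%N%:Z :: circ_from (2 * b + 1)%N%:Z c
      [seq (2 * a + 1)%N%:Z | a <- s])
    ((a + 1)%N%:Z :: circ_from (b + 1)%N%:Z c [seq (a + 1)%N%:Z | a <- s]) k
  = (q ^+ k) ^+ a * (1 + q ^+ k) / qnum q k ^+ (2 * a + 1)
      * \sum_(0 <= j < k) hat_coef (b :: s) j.
  (* The term [j = 0] is zero and is removed first, as the induction hypothesis needs [0 < j]. *)
  rewrite [in RHS]big_ltn // [hat_coef _ 0%N]/= one_coef0 mulr0 add0r.
  under [in RHS]eq_big_nat => j /andP[j0 _] do rewrite -IHs //.
  rewrite exchange_big big_distrr; apply: eq_bigr => c _ /=.
  rewrite /calH_term /= headE circ_from_cons calH_cons -circ_from_cons.
  by rewrite prednK.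
rewrite -[one_coef _ k]/(one_coef (hat_coef (b :: s)) k) /one_coef.
rewrite exprD exprM expr1 [(_ / _) ^+ a]expr_div_n [_ ^+ a.+1]exprS.
by rewrite invfM; ring.
Qed.

Lemma Hhat_hat_sum n p a s t : p = a :: s ->
  Hhat q n p t = \sum_(1 <= k < n.+1) hatw n k * calH_term p t k.
Proof.
move=> ->; apply: eq_bigr => k _; rewrite /hatw /calH_term /= expfzDr ?gt_eqF //.
by rewrite -!mulrA.
Qed.

End QSums.

Theorem theorem3p2 (R : realType) (q : R) (q_gt0 : 0 < q) (q_lt1 : q < 1)
    (m : nat) (m_gt0 : (0 < m)%N) (s : m.-tuple nat) (n : nat)
    (n_gt0 : (0 < n)%N) :
  Hstar q n (twos_ones s) =
  \sum_(c : (m.-1).-tuple bool)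
    Hhat q n (circ c [seq (2 * a + 1)%N%:Z | a <- s])
             (circ c [seq (a + 1)%N%:Z | a <- s]).
Proof.
rewrite Hstar_twos_ones //; case: m m_gt0 s => // m _ [[|a s] // sz_s].
rewrite [tval _](_ : _ = a :: s) //;
have {sz_s} Em : m = size s by move/eqP: sz_s => [].
(* The string is nonempty, so its coefficient vanishes at [k = 0] and the sum starts at 1, as in
   [Hhat]. *)
rewrite {}Em /hat_sum big_ltn // [hat_coef _ _ 0%N]/= one_coef0 mulr0 mulr0 add0r.
under eq_big_nat => k /andP[k0 _] do rewrite -sum_circ // big_distrr.
rewrite exchange_big; apply: eq_bigr => c _ /=.
by rewrite (Hhat_hat_sum _ _ _ (circ_from_cons _ _ _)).
Qed.
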